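(* Let $G$ be a finite simple connected graph with $m\ge 1$ edges, maximum degree $\Delta$ and minimum degree $\delta$. Then $$\frac{\sqrt{(\Delta+\delta)^2 M_2(G)+4\Delta^3\delta\, m(m-1)}}{\Delta(\Delta+\delta)} \le GA_1(G) \le \frac{\sqrt{M_2(G)+\delta^2 m(m-1)}}{\delta},$$ and each of the two equalities holds if and only if $G$ is regular.
   Context: For a graph $G$ with vertex set $V(G)$ and edge set $E(G)$, $d_u$ denotes the degree of the vertex $u$. The first geometric-arithmetic index is $GA_1(G)=\sum_{uv\in E(G)}\frac{2\sqrt{d_ud_v}}{d_u+d_v}$. The second Zagreb index is $M_2(G)=\sum_{uv\in E(G)} d_ud_v$. *)

(* Defs.v *)
From mathcomp Require Import all_boot all_order all_algebra.

Set Implicit Arguments.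
Unset Strict Implicit.
Unset Printing Implicit Defensive.

Import Order.TTheory GRing.Theory Num.Theory.

Record sgraph (T : finType) := SGraph {
  adj :> rel T;
  adj_sym : symmetric adj;
  adj_irrefl : irreflexive adj
}.

Section Graph.

Variables (T : finType) (G : sgraph T).

(* The edge uv is the two-element set [set u; v]; irreflexivity gives u != v. *)
Definition edges : {set {set T}} := [set [set u; v] | u in T, v in T & G u v].

Definition deg (u : T) : nat := #|[set v | G u v]|.

Definition maxdeg : nat := \max_(u : T) deg u.

(* Every degree is less than #|T|, so the default value #|T| never affects *)
(* the minimum when there is at least one vertex.                          *)
Definition mindeg : nat := \big[minn/#|T|]_(u : T) deg u.

Definition connected : Prop := forall u v : T, connect G u v.

Definition regular : Prop := exists k : nat, forall u : T, deg u = k.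

(* Summing over edges e = [set u; v], the product and the sum of the degrees *)
(* over the vertices of e are d_u * d_v and d_u + d_v.                       *)
Definition M2 : nat := \sum_(e in edges) \prod_(u in e) deg u.

Definition GA1 (R : rcfType) : R :=
  (\sum_(e in edges)
     2 * Num.sqrt (\prod_(u in e) deg u)%N%:R / (\sum_(u in e) deg u)%N%:R)%R.

End Graph.

(* Main.v *)
(** Write [t_e] for the summand of [GA1] at the edge [e], so that [GA1 ^ 2] is
    the sum of the [t_e ^ 2] plus the sum of [t_e t_f] over the [m (m - 1)]
    ordered pairs of distinct edges. The latter products lie between
    [4 D d / (D + d) ^ 2] and [1], while [t_e ^ 2 = 4 p / s ^ 2], with [p] and
    [s] the product and sum of the end degrees, lies between [p / D ^ 2] and
    [p / d ^ 2] because [2 d <= s <= 2 D]. Equality on these diagonal terms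
    forces [s = 2 D] (resp. [s = 2 d]) on every edge, hence regularity, as
    connectedness leaves no vertex isolated. *)

Require Import Defs.
From mathcomp Require Import all_boot all_order all_algebra.
From mathcomp Require Import ring lra.

Import Order.TTheory GRing.Theory Num.Theory.

Local Open Scope ring_scope.

(** * Degree bounds, edges as two-element sets, and absence of isolated vertices *)

Section Degrees.

Variables (T : finType) (G : sgraph T).

Lemma deg_le_maxdeg u : (deg G u <= maxdeg G)%N.
Proof. exact: leq_bigmax. Qed.

Lemma mindeg_le_deg u : (mindeg G <= deg G u)%N.
Proof.
rewrite /mindeg; have := mem_index_enum u.
elim: (index_enum T) => //= x s IH; rewrite inE big_cons geq_min.
by case/orP => [/eqP->|/IH->]; rewrite ?leqnn ?orbT.
Qed.

(** The default value of [mindeg] enters the minimum as one more term, hence the hypothesis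
    [k <= #|T|]. *)
Lemma leq_mindeg k :
  (k <= #|T|)%N -> (forall u, k <= deg G u)%N -> (k <= mindeg G)%N.
Proof.
move=> kT kdeg; rewrite /mindeg; apply: (big_ind (fun x => k <= x)%N) => //.
by move=> x y kx ky; rewrite leq_min kx.
Qed.

Lemma edgesP e :
  reflect (exists u v, G u v /\ e = [set u; v]) (e \in edges G).
Proof.
apply: (iffP imset2P) => [[u v _]|[u [v [Guv ->]]]].
  by rewrite inE => /andP[_ Guv] ->; exists u, v.
by exists u v; rewrite // inE Guv.
Qed.

Lemma prod_deg_edge u v :
  G u v -> (\prod_(w in [set u; v]) deg G w = deg G u * deg G v)%N.
Proof.
move=> Guv; rewrite big_setU1 ?big_set1 // inE.
by apply: contraTneq Guv => ->; rewrite (adj_irrefl G).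
Qed.

Lemma sum_deg_edge u v :
  G u v -> (\sum_(w in [set u; v]) deg G w = deg G u + deg G v)%N.
Proof.
move=> Guv; rewrite big_setU1 ?big_set1 // inE.
by apply: contraTneq Guv => ->; rewrite (adj_irrefl G).
Qed.

Lemma maxdeg_regular k : (0 < #|T|)%N -> (forall u, deg G u = k) -> maxdeg G = k.
Proof.
case/card_gt0P => u _ Gk; apply/eqP; rewrite eqn_leq -{2}(Gk u) deg_le_maxdeg.
by rewrite andbT; apply/bigmax_leqP => v _; rewrite Gk.
Qed.

Lemma mindeg_regular k : (0 < #|T|)%N -> (forall u, deg G u = k) -> mindeg G = k.
Proof.
case/card_gt0P => u _ Gk; apply/eqP; rewrite eqn_leq -{1}(Gk u) mindeg_le_deg.
by apply: leq_mindeg => [|v]; [rewrite -(Gk u) max_card | rewrite Gk].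
Qed.

Hypotheses (Gconn : connected G) (Gm : (1 <= #|edges G|)%N).

(** An edge provides two distinct vertices, so some [w] differs from [u]. A path from [u] to [w] is
    then nonempty, and its first step is a neighbour of [u]. *)
Lemma connected_neighbour u : exists v, G u v.
Proof.
have [_ /edgesP[a [b [Gab _]]]] := card_gt0P Gm.
have [w uw] : exists w, u != w.
  have [ua|] := eqVneq u a; last by exists a.
  by exists b; apply: contraTneq Gab => <-; rewrite ua (adj_irrefl G).
have /connectP[[|v p] /= Gp uE] := Gconn u w; first by rewrite uE eqxx in uw.
by exists v; case/andP: Gp.
Qed.

Lemma mindeg_gt0 : (0 < mindeg G)%N.
Proof.
apply: leq_mindeg => [|u].
  have [_ /edgesP[a _]] := card_gt0P Gm.
  by apply/card_gt0P; exists a.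
by have [v Guv] := connected_neighbour u; apply/card_gt0P; exists v; rewrite inE.
Qed.

(** Every vertex is an end of some edge, so information about the ends of edges reaches all
    vertices. *)
Lemma regular_of_edge_sum k :
    (forall u v, G u v -> deg G u = k /\ deg G v = k) -> regular G.
Proof.
by move=> Gk; exists k => u; have [v /Gk[]] := connected_neighbour u.
Qed.

End Degrees.

(** * Sums over pairs of indices, and comparisons with a quotient of a square root *)

Section Reals.

Variable R : rcfType.

Lemma sqr_sum_diag (I : finType) (A : {set I}) (t : I -> R) :
  (\sum_(i in A) t i) ^+ 2 =
  \sum_(i in A) t i ^+ 2 + \sum_(i in A) \sum_(j in A | j != i) t i * t j.
Proof.
rewrite expr2 big_distrlr -big_split /=; apply: eq_bigr => i Ai.
by rewrite (bigD1 i Ai).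
Qed.

Lemma sum_offdiag (I : finType) (A : {set I}) (c : R) :
  \sum_(i in A) \sum_(j in A | j != i) c = c * (#|A|%:R * (#|A|%:R - 1)).
Proof.
have E i : i \in A -> \sum_(j in A | j != i) c = c * (#|A|%:R - 1).
  move=> Ai; have : \sum_(j in A) c = c *+ #|A| by rewrite sumr_const.
  rewrite (bigD1 i Ai) /= -mulr_natr => /(canRL (addKr _)) ->.
  by ring.
by rewrite (eq_bigr _ E) sumr_const -mulr_natr; ring.
Qed.

(** Both slacks, that of the sums and that of [x <= y], are nonnegative; if the totals agree, both
    vanish, and a termwise bounded sum attains its bound only termwise. Here [f] and [g] will be
    diagonal terms, [x] and [y] off-diagonal totals. *)
Lemma ler_sumD_eq (I : finType) (A : {set I}) (f g : I -> R) (x y : R) :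
    (forall i, i \in A -> f i <= g i) -> x <= y ->
  (\sum_(i in A) f i + x <= \sum_(i in A) g i + y) /\
  (\sum_(i in A) f i + x = \sum_(i in A) g i + y ->
   forall i, i \in A -> f i = g i).
Proof.
move=> fg xy.
have fg' i : i \in A -> f i <= g i ?= iff (f i == g i) by move=> /fg; split.
have [le_fg eq_fg] := leif_sum fg'.
split=> [|eq_sum i Ai]; first exact: lerD.
have /eqP : \sum_(i in A) f i = \sum_(i in A) g i by lra.
by rewrite eq_fg => /forall_inP/(_ i Ai)/eqP.
Qed.

Lemma sqrt_divK_le (x y k : R) :
  0 < k -> 0 <= y -> (Num.sqrt x / k <= y) = (x <= (y * k) ^+ 2).
Proof.
move=> k0 y0; have yk0 : 0 <= y * k by rewrite mulr_ge0 ?(ltW k0).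
by rewrite ler_pdivrMr // -{1}(ger0_norm yk0) -sqrtr_sqr ler_sqrt ?sqr_ge0.
Qed.

(** [Num.sqrt] is [0] on negative arguments, so for [y = 0] and negative [x] the left side would
    hold and the right side fail; [0 <= x] excludes this. *)
Lemma sqrt_divK_ge (x y k : R) :
  0 < k -> 0 <= y -> 0 <= x -> (y <= Num.sqrt x / k) = ((y * k) ^+ 2 <= x).
Proof.
move=> k0 y0 x0; have yk0 : 0 <= y * k by rewrite mulr_ge0 ?(ltW k0).
by rewrite ler_pdivlMr // -{1}(ger0_norm yk0) -sqrtr_sqr ler_sqrt.
Qed.

Lemma sqrt_divK_eq (x y k : R) :
  0 < k -> 0 <= y -> 0 <= x -> (Num.sqrt x / k = y) <-> (x = (y * k) ^+ 2).
Proof.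
move=> k0 y0 x0; split=> [<-|->].
  by rewrite divfK ?gt_eqF // sqr_sqrtr.
by rewrite sqrtr_sqr ger0_norm ?mulr_ge0 ?(ltW k0) // mulfK ?gt_eqF.
Qed.

(** * Estimates for one summand [t], with end degrees [a] and [b] between [d] and [D] *)

Section GeometricArithmetic.

Variables a b d D : R.
Hypotheses (d0 : 0 < d) (da : d <= a) (db : d <= b) (aD : a <= D) (bD : b <= D).

Let t := 2 * Num.sqrt (a * b) / (a + b).
Let a0 : 0 < a := lt_le_trans d0 da.
Let b0 : 0 < b := lt_le_trans d0 db.
Let D0 : 0 < D := lt_le_trans a0 aD.
Let s0 : 0 < a + b := addr_gt0 a0 b0.

Lemma ga_ge0 : 0 <= t.
Proof. by rewrite divr_ge0 ?(ltW s0) // mulr_ge0 ?sqrtr_ge0. Qed.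

Lemma ga_sqr : t ^+ 2 = 4 * (a * b) / (a + b) ^+ 2.
Proof.
rewrite /t expr_div_n exprMn sqr_sqrtr ?mulr_ge0 ?(ltW a0) ?(ltW b0) //.
by congr (_ * _ / _); ring.
Qed.

(** This is the arithmetic-geometric mean inequality, squared: [(a + b) ^+ 2 - 4 * (a * b) = (a - b)
    ^+ 2]. *)
Lemma ga_le1 : t <= 1.
Proof.
rewrite -ler_sqr ?nnegrE ?ga_ge0 // ga_sqr expr1n ler_pdivrMr ?exprn_gt0 //.
have := sqr_ge0 (a - b); nra.
Qed.

(** After squaring and clearing denominators the difference factors, and both factors are
    nonnegative because [b * d <= D * a] and [a * d <= D * b]. *)
Lemma ga_ge : 2 * Num.sqrt (D * d) / (D + d) <= t.
Proof.
have Dd0 : 0 < D + d by rewrite addr_gt0.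
have c0 : 0 <= 2 * Num.sqrt (D * d) / (D + d).
  by rewrite divr_ge0 ?(ltW Dd0) // mulr_ge0 ?sqrtr_ge0.
rewrite -ler_sqr ?nnegrE ?ga_ge0 // ga_sqr expr_div_n exprMn.
rewrite sqr_sqrtr ?mulr_ge0 ?(ltW d0) ?(ltW D0) //.
rewrite ler_pdivrMr ?exprn_gt0 // [leRHS]mulrAC.
rewrite ler_pdivlMr ?exprn_gt0 // -subr_ge0.
have ->: 4 * (a * b) * (D + d) ^+ 2 - 2 ^+ 2 * (D * d) * (a + b) ^+ 2
         = 4 * ((D * a - b * d) * (D * b - a * d)) by ring.
by rewrite !mulr_ge0 // subr_ge0 ler_pM // ltW.
Qed.

Lemma ga_sqr_ge : a * b / D ^+ 2 <= t ^+ 2.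
Proof.
rewrite ga_sqr ler_pdivrMr ?exprn_gt0 // mulrAC ler_pdivlMr ?exprn_gt0 //.
have ->: 4 * (a * b) * D ^+ 2 = (a * b) * (2 * D) ^+ 2 by ring.
rewrite ler_wpM2l ?mulr_ge0 ?(ltW a0) ?(ltW b0) //.
by rewrite mulr_natl mulr2n ler_sqr ?nnegrE ?(ltW s0) ?addr_ge0 ?(ltW D0) ?lerD.
Qed.

Lemma ga_sqr_le : t ^+ 2 <= a * b / d ^+ 2.
Proof.
rewrite ga_sqr ler_pdivlMr ?exprn_gt0 // mulrAC ler_pdivrMr ?exprn_gt0 //.
have ->: 4 * (a * b) * d ^+ 2 = (a * b) * (2 * d) ^+ 2 by ring.
rewrite ler_wpM2l ?mulr_ge0 ?(ltW a0) ?(ltW b0) //.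
by rewrite mulr_natl mulr2n ler_sqr ?nnegrE ?(ltW s0) ?addr_ge0 ?(ltW d0) ?lerD.
Qed.

(** Cancelling the nonzero [a * b] leaves two equal squares of nonnegative numbers. It serves the
    equality cases, with [k] equal to [D] or [d]. *)
Lemma ga_sqr_eq k : 0 < k -> t ^+ 2 = a * b / k ^+ 2 -> a + b = 2 * k.
Proof.
move=> k0; rewrite ga_sqr.
have s20 : (a + b) ^+ 2 != 0 by rewrite expf_neq0 ?gt_eqF.
have k20 : k ^+ 2 != 0 by rewrite expf_neq0 ?gt_eqF.
move/eqP; rewrite eqr_div //.
have ->: 4 * (a * b) * k ^+ 2 = (a * b) * (2 * k) ^+ 2 by ring.
have ab0 : a * b != 0 by rewrite mulf_neq0 ?gt_eqF.
rewrite (inj_eq (mulfI ab0)) eqrXn2 ?(ltW s0) ?mulr_ge0 ?(ltW k0) //.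
by move/eqP.
Qed.

End GeometricArithmetic.

End Reals.

(** * Assembly of the two bounds on the squared index and their equality cases *)

Theorem theorem2p3 (R : rcfType) (T : finType) (G : sgraph T)
    (Gconn : connected G) (Gm : (1 <= #|edges G|)%N) :
  let m : R := #|edges G|%:R in
  let D : R := (maxdeg G)%:R in
  let d : R := (mindeg G)%:R in
  let M : R := (M2 G)%:R in
  let lower := Num.sqrt ((D + d) ^+ 2 * M + 4 * D ^+ 3 * d * (m * (m - 1)))
                 / (D * (D + d)) in
  let upper := Num.sqrt (M + d ^+ 2 * (m * (m - 1))) / d in
  [/\ lower <= GA1 G R,
      GA1 G R <= upper,
      lower = GA1 G R <-> regular G
    & GA1 G R = upper <-> regular G].
Proof.
move=> m D d M lower upper.
pose p (e : {set T}) : R := (\prod_(u in e) deg G u)%N%:R.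
pose t (e : {set T}) : R := 2 * Num.sqrt (p e) / (\sum_(u in e) deg G u)%N%:R.
(* The value a summand would take at an edge joining a vertex of degree [D] to one of degree [d]. *)
pose c : R := 2 * Num.sqrt (D * d) / (D + d).
have tE u v : G u v -> p [set u; v] = (deg G u)%:R * (deg G v)%:R /\
    t [set u; v] = 2 * Num.sqrt ((deg G u)%:R * (deg G v)%:R)
                   / ((deg G u)%:R + (deg G v)%:R).
  by move=> Guv; rewrite /t /p prod_deg_edge // sum_deg_edge // natrM natrD.
have d0 : 0 < d by rewrite ltr0n mindeg_gt0.
have dle u : d <= (deg G u)%:R by rewrite ler_nat mindeg_le_deg.
have leD u : (deg G u)%:R <= D by rewrite ler_nat deg_le_maxdeg.
have D0 : 0 < D.
  have [_ /edgesP[u _]] := card_gt0P Gm.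
  exact: lt_le_trans d0 (le_trans (dle u) (leD u)).
have Dd0 : 0 < D + d by rewrite addr_gt0.
have c0 : 0 <= c by rewrite divr_ge0 ?(ltW Dd0) // mulr_ge0 ?sqrtr_ge0.
have m1 : 0 <= m * (m - 1) by rewrite mulr_ge0 // subr_ge0 ler1n.
have t0 e : e \in edges G -> 0 <= t e.
  by case/edgesP => u [v [/tE[_ ttE] ->]]; rewrite ttE (ga_ge0 _ _ _ d).
have tc e : e \in edges G -> c <= t e.
  by case/edgesP => u [v [/tE[_ ttE] ->]]; rewrite ttE; apply: ga_ge.
have t1 e : e \in edges G -> t e <= 1.
  by case/edgesP => u [v [/tE[_ ttE] ->]]; rewrite ttE (ga_le1 _ _ _ d).
have tD e : e \in edges G -> p e / D ^+ 2 <= t e ^+ 2.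
  case/edgesP => u [v [/tE[pE ttE] ->]]; rewrite ttE pE; exact: (ga_sqr_ge _ _ _ d).
have td e : e \in edges G -> t e ^+ 2 <= p e / d ^+ 2.
  by case/edgesP => u [v [/tE[pE ttE] ->]]; rewrite ttE pE; exact: ga_sqr_le.
have teq k u v : 0 < k -> G u v -> t [set u; v] ^+ 2 = p [set u; v] / k ^+ 2 ->
    (deg G u)%:R + (deg G v)%:R = 2 * k.
  by move=> k0 /tE[-> ->]; exact: (ga_sqr_eq _ _ _ d).
have ME k : \sum_(e in edges G) p e / k = M / k.
  by rewrite -mulr_suml /M /M2 natr_sum.
pose off := \sum_(e in edges G) \sum_(f in edges G | f != e) t e * t f.
have GAE : GA1 G R ^+ 2 = \sum_(e in edges G) t e ^+ 2 + off.
  exact: sqr_sum_diag.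
have GA0 : 0 <= GA1 G R by apply: sumr_ge0.
have off_ge : c ^+ 2 * (m * (m - 1)) <= off.
  rewrite -sum_offdiag; apply: ler_sum => e Ee; apply: ler_sum => f /andP[Ef _].
  by rewrite expr2 ler_pM // tc.
have off_le : off <= 1 * (m * (m - 1)).
  rewrite -sum_offdiag; apply: ler_sum => e Ee; apply: ler_sum => f /andP[Ef _].
  by rewrite -[1]mulr1 ler_pM ?t0 ?t1.
have [low low_eq] := ler_sumD_eq _ _ _ _ _ _ _ tD off_ge.
have [upp upp_eq] := ler_sumD_eq _ _ _ _ _ _ _ td off_le.
rewrite -!GAE !ME in low low_eq upp upp_eq.
have c2 : c ^+ 2 = 4 * (D * d) / (D + d) ^+ 2.
  rewrite expr_div_n exprMn sqr_sqrtr ?mulr_ge0 ?(ltW D0) ?(ltW d0) //.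
  by congr (_ * _ / _); ring.
(* Taking the squared denominator out of the radicand leaves exactly the lower bound on
   [GA1 G R ^+ 2], since [c ^+ 2 * (D * (D + d)) ^+ 2 = 4 * D ^+ 3 * d]. *)
have lowE : (D + d) ^+ 2 * M + 4 * D ^+ 3 * d * (m * (m - 1)) =
    (M / D ^+ 2 + c ^+ 2 * (m * (m - 1))) * (D * (D + d)) ^+ 2.
  by rewrite c2; field; rewrite !gt_eqF.
have uppE : M + d ^+ 2 * (m * (m - 1)) =
    (M / d ^+ 2 + 1 * (m * (m - 1))) * d ^+ 2.
  by field; rewrite gt_eqF.
have M0 : 0 <= M by [].
have K0 : 0 < D * (D + d) by rewrite mulr_gt0.
have K2 : (D * (D + d)) ^+ 2 != 0 by rewrite expf_neq0 ?gt_eqF.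
have d2 : d ^+ 2 != 0 by rewrite expf_neq0 ?gt_eqF.
have low0 : 0 <= M / D ^+ 2 + c ^+ 2 * (m * (m - 1)).
  exact: addr_ge0 (divr_ge0 M0 (sqr_ge0 D)) (mulr_ge0 (sqr_ge0 c) m1).
have upp0 : 0 <= M / d ^+ 2 + 1 * (m * (m - 1)).
  exact: addr_ge0 (divr_ge0 M0 (sqr_ge0 d)) (mulr_ge0 ler01 m1).
have eq_lower : lower = GA1 G R <->
    M / D ^+ 2 + c ^+ 2 * (m * (m - 1)) = GA1 G R ^+ 2.
  rewrite /lower lowE sqrt_divK_eq ?(mulr_ge0 low0) ?(mulr_ge0 upp0) ?sqr_ge0 // [(GA1 G R * _) ^+ 2]exprMn.
  by split=> [/(mulIf K2)|->].
have eq_upper : GA1 G R = upper <->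
    GA1 G R ^+ 2 = M / d ^+ 2 + 1 * (m * (m - 1)).
  rewrite /upper uppE; split=> [/esym|E]; last apply/esym.
    rewrite sqrt_divK_eq ?(mulr_ge0 low0) ?(mulr_ge0 upp0) ?sqr_ge0 // [(GA1 G R * _) ^+ 2]exprMn.
    by move/(mulIf d2).
  by rewrite sqrt_divK_eq ?(mulr_ge0 low0) ?(mulr_ge0 upp0) ?sqr_ge0 // [(GA1 G R * _) ^+ 2]exprMn E.
(* In a regular graph each summand is [1], and both bounds on the squared index become
   [m + m * (m - 1) = m ^+ 2]. *)
have reg_eq : regular G -> GA1 G R = m /\ [/\ M = m * D ^+ 2, c = 1 & d = D].
  case=> k Gk; have T0 : (0 < #|T|)%N.
    by have [_ /edgesP[u _]] := card_gt0P Gm; apply/card_gt0P; exists u.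
  have Dk : D = k%:R by rewrite /D (maxdeg_regular _ _ _ T0 Gk).
  have dk : d = k%:R by rewrite /d (mindeg_regular _ _ _ T0 Gk).
  have k0 : 0 < k%:R :> R by rewrite -dk.
  have one : 2 * Num.sqrt (k%:R * k%:R) / (k%:R + k%:R) = 1 :> R.
    by rewrite -expr2 sqrtr_sqr ger0_norm ?(ltW k0) //; field; rewrite gt_eqF ?addr_gt0.
  rewrite /c dk Dk; split; last split=> //.
    rewrite /GA1 (eq_bigr (fun=> 1)) ?sumr_const // => _ /edgesP[u [v [/tE[_ ttE] ->]]].
    by rewrite [LHS]ttE !Gk.
  rewrite /M /M2 natr_sum (eq_bigr (fun=> k%:R ^+ 2)) ?sumr_const ?mulr_natl //.
  by move=> _ /edgesP[u [v [/tE[pE _] ->]]]; rewrite [LHS]pE !Gk expr2.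
split.
- by rewrite /lower lowE sqrt_divK_le // [(GA1 G R * _) ^+ 2]exprMn ler_wpM2r ?sqr_ge0.
- by rewrite /upper uppE sqrt_divK_ge ?(mulr_ge0 low0) ?(mulr_ge0 upp0) ?sqr_ge0 // [(GA1 G R * _) ^+ 2]exprMn ler_wpM2r ?sqr_ge0.
- rewrite eq_lower; split=> [E|/reg_eq[-> [-> -> _]]].
    apply: (regular_of_edge_sum _ _ Gconn Gm (maxdeg G)) => u v Guv.
    have Ee : [set u; v] \in edges G by apply/edgesP; exists u, v.
    (* Equality on the diagonal term gives end degrees with sum [2 * D]; as neither exceeds [D],
       both equal [D]. *)
    have s2 := teq D u v D0 Guv (esym (low_eq E _ Ee)).
    have [uD vD] := (leD u, leD v).
    by split; apply/eqP; rewrite -(eqr_nat R) -/D; apply/eqP; lra.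
  by field; rewrite gt_eqF.
- rewrite eq_upper; split=> [E|/reg_eq[-> [-> _ ->]]].
    apply: (regular_of_edge_sum _ _ Gconn Gm (mindeg G)) => u v Guv.
    have Ee : [set u; v] \in edges G by apply/edgesP; exists u, v.
    (* Dually, two degrees that are at least [d] and sum to [2 * d] both equal [d]. *)
    have s2 := teq d u v d0 Guv (upp_eq E _ Ee).
    have [ud vd] := (dle u, dle v).
    by split; apply/eqP; rewrite -(eqr_nat R) -/d; apply/eqP; lra.
  by field; rewrite gt_eqF.
Qed.
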